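(* Let $G$ be a finite group, $K\le G$ a subgroup, $(\theta,V)$ an irreducible representation of $K$ of dimension $d_\theta$, and $v\in V$ with $\|v\|=1$. Define $\psi\in L(K)\subseteq L(G)$ by $\psi(k)=\frac{d_\theta}{|K|}\langle v,\theta(k)v\rangle$ for $k\in K$ (and $\psi=0$ off $K$), and define $T_v:\mathrm{Ind}_K^GV\to L(G)$ by $$(T_vf)(g)=\sqrt{d_\theta/|K|}\,\langle f(g),v\rangle,\qquad f\in\mathrm{Ind}_K^GV,\ g\in G.$$ (1) The operator $T_v$ belongs to $\mathrm{Hom}_G(\mathrm{Ind}_K^GV,L(G))$ and it is an isometry. (2) The operator $P:L(G)\to L(G)$ defined by $Pf=f*\psi$ for all $f\in L(G)$ is the orthogonal projection of $L(G)$ onto $T_v[\mathrm{Ind}_K^GV]$.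
   Context: Scalar products are Hermitian and linear in the first argument; all representations are finite-dimensional, complex and unitary. $L(G)$ is the space of functions $f:G\to\mathbb C$ with scalar product $\langle f_1,f_2\rangle=\sum_{g\in G}f_1(g)\overline{f_2(g)}$, convolution $(f_1*f_2)(g)=\sum_{g_0\in G}f_1(gg_0^{-1})f_2(g_0)$, and the left regular representation $[\lambda_G(g)f](g_0)=f(g^{-1}g_0)$. Functions on $K$ are regarded as functions on $G$ by extension by zero. $\mathrm{Ind}_K^GV=\{f:G\to V: f(gk)=\theta(k^{-1})f(g)\ \forall g\in G,k\in K\}$ with $G$-action $[\lambda(g_0)f](g)=f(g_0^{-1}g)$ and scalar product $\langle f_1,f_2\rangle=\frac1{|K|}\sum_{g\in G}\langle f_1(g),f_2(g)\rangle_V$. $\mathrm{Hom}_G$ denotes the space of $G$-intertwining linear operators. *)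

(* Defs.v *)
From HB Require Import structures.
From mathcomp Require Import all_boot all_order all_algebra all_fingroup.

Set Implicit Arguments.
Unset Strict Implicit.
Unset Printing Implicit Defensive.

Import Order.TTheory GRing.Theory Num.Theory Num.Def.
Local Open Scope ring_scope.

(* A form [dot : {dot V for conjC}] is linear in its first argument and
   conjugate-linear in its second one. *)

Section Representations.
Variables (C : numClosedFieldType) (gT : finGroupType).

(* The values of [rho] outside of [K] are irrelevant (as in [mx_repr]). *)
Definition unitary_repr (K : {group gT}) (V : vectType C)
    (dot : {dot V for conjC}) (rho : gT -> 'End(V)) : Prop :=
  [/\ rho 1%g = \1%VF,
      {in K &, forall h k, rho (h * k)%g = (rho h \o rho k)%VF}
    & {in K, forall k, isometry dot dot (rho k)}].

Definition irreducible_repr (K : {group gT}) (V : vectType C)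
    (rho : gT -> 'End(V)) : Prop :=
  (fullv : {vspace V}) <> 0%VS /\
  forall U : {vspace V},
    {in K, forall k, (rho k @: U <= U)%VS} -> U = 0%VS \/ U = fullv.

(* [T] belongs to Hom_G(U, W), where G is the whole group [gT]. *)
Definition intertwiner (U W : lmodType C) (rho : gT -> U -> U)
    (sigma : gT -> W -> W) (T : U -> W) : Prop :=
  linear T /\ forall g u, T (rho g u) = sigma g (T u).

Definition orthogonal_projection (U : lmodType C) (dot : {dot U for conjC})
    (W : U -> Prop) (P : U -> U) : Prop :=
  linear P /\
  forall u, W (P u) /\ forall w, W w -> dot (u - P u) w = 0.

End Representations.

Section GroupFunctions.
Variables (C : numClosedFieldType) (gT : finGroupType).

Definition L : vectType C := {ffun gT -> C^o}.

Definition dotL (f1 f2 : L) : C := \sum_(g : gT) f1 g * (f2 g)^*.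

Definition conv (f1 f2 : L) : L :=
  [ffun g => \sum_(g0 : gT) f1 (g * g0^-1)%g * f2 g0].

Definition lambdaL (g : gT) (f : L) : L := [ffun g0 => f (g^-1 * g0)%g].

Fact dotL_linearl f : linear_for *%R (dotL ^~ f).
Proof.
move=> a u v; rewrite /dotL mulr_sumr -big_split; apply: eq_bigr => g _ /=.
by rewrite !ffunE mulrDl mulrA.
Qed.

Fact dotL_linearr f : linear_for (conjC \; *%R) (dotL f).
Proof.
move=> a u v; rewrite /dotL /= mulr_sumr -big_split; apply: eq_bigr => g _ /=.
by rewrite !ffunE rmorphD rmorphM mulrDr mulrCA.
Qed.

HB.instance Definition _ :=
  bilinear_isBilinear.Build C L L C *%R (conjC \; *%R) dotL
    (dotL_linearl, dotL_linearr).

Fact dotL_herm u v : dotL u v = (-1) ^+ false * (dotL v u)^*.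
Proof.
rewrite expr0 mul1r rmorph_sum; apply: eq_bigr => g _.
by rewrite rmorphM /= conjCK mulrC.
Qed.

HB.instance Definition _ :=
  isHermitianSesquilinear.Build C L false conjC dotL dotL_herm.

Fact dotL_pos u : u != 0 -> 0 < dotL u u.
Proof.
move=> u0; have ge0 g : true -> 0 <= u g * (u g)^*.
  by move=> _; apply: mul_conjC_ge0.
rewrite lt0r sumr_ge0 ?andbT //; apply: contraNneq u0 => /psumr_eq0P u0.
apply/eqP/ffunP => g; rewrite ffunE.
by apply/eqP; rewrite -mul_conjC_eq0 u0.
Qed.

HB.instance Definition _ := isDotProduct.Build C L dotL dotL_pos.

End GroupFunctions.

Section Induced.
Variables (C : numClosedFieldType) (gT : finGroupType) (K : {group gT}).
Variables (V : vectType C) (dotV : {dot V for conjC}) (theta : gT -> 'End(V)).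

Definition ind_pred : {pred {ffun gT -> V}} :=
  fun f => [forall g, forall k in K, f (g * k)%g == theta k^-1%g (f g)].

Fact ind_submod_closed : submod_closed ind_pred.
Proof.
split=> [|a u v uP vP].
  by apply/forallP=> g; apply/forall_inP => k kK; rewrite !ffunE linear0.
apply/forallP=> g; apply/forall_inP => k kK; rewrite !ffunE linearP.
by move/forallP/(_ g)/forall_inP/(_ k kK)/eqP: uP => ->;
   move/forallP/(_ g)/forall_inP/(_ k kK)/eqP: vP => ->.
Qed.

HB.instance Definition _ :=
  GRing.isSubmodClosed.Build C {ffun gT -> V} ind_pred ind_submod_closed.

Record Ind := MkInd { ind_fun : {ffun gT -> V}; _ : ind_fun \in ind_pred }.

HB.instance Definition _ := [isSub for ind_fun].
HB.instance Definition _ := [Choice of Ind by <:].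
HB.instance Definition _ := [SubChoice_isSubLmodule of Ind by <:].

Definition dotInd (f1 f2 : Ind) : C :=
  #|K|%:R^-1 * \sum_(g : gT) dotV (ind_fun f1 g) (ind_fun f2 g).

Fact lambdaInd_subproof (g : gT) (f : Ind) :
  [ffun g0 => ind_fun f (g^-1 * g0)%g] \in ind_pred.
Proof.
apply/forallP=> x; apply/forall_inP => k kK; rewrite !ffunE.
by case: f => f /= /forallP/(_ (g^-1 * x)%g)/forall_inP/(_ k kK); rewrite mulgA.
Qed.

Definition lambdaInd (g : gT) (f : Ind) : Ind :=
  MkInd (lambdaInd_subproof g f).

Fact dotInd_linearl f : linear_for *%R (dotInd ^~ f).
Proof.
move=> a u v; rewrite /dotInd /= mulrCA -mulrDr; congr (_ * _).
rewrite mulr_sumr -big_split; apply: eq_bigr => g _ /=; rewrite !ffunE; apply: linearPl.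
Qed.

Fact dotInd_linearr f : linear_for (conjC \; *%R) (dotInd f).
Proof.
move=> a u v; rewrite /dotInd /= mulrCA -mulrDr; congr (_ * _).
rewrite mulr_sumr -big_split; apply: eq_bigr => g _ /=; rewrite !ffunE; apply: linearPr.
Qed.

HB.instance Definition _ :=
  bilinear_isBilinear.Build C Ind Ind C *%R (conjC \; *%R) dotInd
    (dotInd_linearl, dotInd_linearr).

Fact dotInd_herm u v : dotInd u v = (-1) ^+ false * (dotInd v u)^*.
Proof.
rewrite expr0 mul1r rmorphM fmorphV rmorph_nat rmorph_sum; congr (_ * _).
by apply: eq_bigr => g _; rewrite hermC expr0 mul1r.
Qed.

HB.instance Definition _ :=
  isHermitianSesquilinear.Build C Ind false conjC dotInd dotInd_herm.

Fact dotInd_pos u : u != 0 -> 0 < dotInd u u.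
Proof.
move=> u0; have ge0 g : true -> 0 <= dotV (ind_fun u g) (ind_fun u g).
  by move=> _; apply: dnorm_ge0.
rewrite pmulr_rgt0 ?invr_gt0 ?ltr0n ?cardG_gt0 //.
rewrite lt0r sumr_ge0 ?andbT //; apply: contraNneq u0 => /psumr_eq0P u0.
apply/eqP/val_inj/ffunP => g; rewrite /= ffunE.
by apply/eqP; rewrite -(dnorm_eq0 dotV) u0.
Qed.

HB.instance Definition _ := isDotProduct.Build C Ind dotInd dotInd_pos.

Definition psi (v : V) : L C gT :=
  [ffun k => if k \in K
             then (\dim {:V})%:R / #|K|%:R * dotV v (theta k v) else 0].

Definition Tv (v : V) (f : Ind) : L C gT :=
  [ffun g => sqrtC ((\dim {:V})%:R / #|K|%:R) * dotV (ind_fun f g) v].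

End Induced.

Arguments dotL C gT f1 f2 : clear implicits.
Arguments lambdaL C gT g f : clear implicits.
Arguments Ind {C gT} K {V} theta.
Arguments dotInd {C gT} K {V} dotV theta f1 f2.
Arguments lambdaInd {C gT} K {V} theta g f.
Arguments psi {C gT} K {V} dotV theta v.
Arguments Tv {C gT} K {V} dotV theta v f.

(* Main.v *)
(** Schur's lemma makes the rank-one frame
    [u |-> \sum_(k in K) <u, theta k v> theta k v] equal to [c u], and comparing
    traces gives [c = |K| / d] when [|v| = 1].  Averaging over the cosets of [K]
    turns this identity into the isometry of [T].  If [T*] is the adjoint of
    [T], then [P = T T*], and this is the projection onto the image of [T]
    because [T* T = id]. *)

From HB Require Import structures.
Require Import Defs.
From mathcomp Require Import all_boot all_order all_algebra all_fingroup.
From mathcomp Require Import reals complex.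
Import GRing.Theory Num.Theory Num.Def.
Local Open Scope ring_scope.

Set Implicit Arguments.
Unset Strict Implicit.
Unset Printing Implicit Defensive.

Section Schur.
Variables (C : numClosedFieldType) (V : vectType C).

(** The characteristic polynomial of the matrix of [A] in a basis has a root in [C]; a nonzero [V]
    makes that matrix nonempty. *)
Lemma leigenvalue_closed (A : 'End(V)) :
  (fullv : {vspace V}) <> 0%VS -> exists a : C, passmx.leigenvalue A a.
Proof.
move=> /eqP; rewrite -dimv_eq0 -lt0n => dimV_gt0.
have [a aA] := eigenvalue_closed
  (passmx.mxof (vbasis {:V}) (vbasis {:V}) A) dimV_gt0.
exists a; rewrite /passmx.leigenvalue.
by rewrite (passmx.leigenspaceE (vbasisP {:V})) passmx.vsof_eq0 ?vbasisP.
Qed.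

(** An eigenspace of [A] is stable under every [rho k], as [A] commutes with them. It is nonzero,
    hence everything by irreducibility. *)
Lemma schur (gT : finGroupType) (K : {group gT}) (rho : gT -> 'End(V))
    (A : 'End(V)) :
    irreducible_repr K rho ->
    {in K, forall k u, A (rho k u) = rho k (A u)} ->
  exists a : C, A =1 *:%R a.
Proof.
move=> [V_neq0 irr] A_comm; have [a a_eig] := leigenvalue_closed A V_neq0.
have memE u : (u \in passmx.leigenspace A a) = (A u == a *: u).
  by rewrite memv_ker add_lfunE opp_lfunE scale_lfunE id_lfunE subr_eq0.
exists a => u; apply/eqP; rewrite -memE.
case: (irr (passmx.leigenspace A a)) => [k kK|eig0|->].
- apply/subvP => _ /memv_imgP[w wE ->]; move: wE; rewrite !memE => /eqP wE.
  by rewrite A_comm // wE linearZ.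
- by rewrite /passmx.leigenvalue eig0 eqxx in a_eig.
- exact: memvf.
Qed.

End Schur.

Section Frame.
Variables (C : numClosedFieldType) (gT : finGroupType) (K : {group gT}).
Variables (V : vectType C) (dotV : {dot V for conjC}) (theta : gT -> 'End(V)).
Variable v : V.

Hypothesis theta_unitary : unitary_repr K dotV theta.
Hypothesis theta_irr : irreducible_repr K theta.
Hypothesis v_unit : dotV v v = 1.

Local Notation d := ((\dim {:V})%:R : C).
Local Notation "''[' x , y ]" := (dotV x y).

Lemma dot_conj x y : '[x, y]^* = '[y, x].
Proof. by rewrite [RHS]hermC expr0 mul1r. Qed.

Lemma reprM h k u : h \in K -> k \in K ->
  theta (h * k)%g u = theta h (theta k u).
Proof. by case: theta_unitary => _ thM _ hK kK; rewrite thM // lfunE. Qed.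

Lemma repr_iso k x y : k \in K -> '[theta k x, theta k y] = '[x, y].
Proof. by case: theta_unitary => _ _ iso kK; apply: iso. Qed.

Lemma repr_adj k x y : k \in K -> '[theta k^-1%g x, y] = '[x, theta k y].
Proof.
move=> kK; rewrite -(@repr_iso k) // -reprM ?groupV // mulgV.
by case: theta_unitary => -> _ _; rewrite id_lfunE.
Qed.

Lemma sum_mull (M : nmodType) h (F : gT -> M) : h \in K ->
  \sum_(k in K) F (h * k)%g = \sum_(k in K) F k.
Proof.
move=> hK; rewrite [RHS](reindex_inj (mulgI h)).
by apply: eq_bigl => k; rewrite groupMl.
Qed.

Lemma dim_neq0 : d != 0.
Proof. by case: theta_irr => /eqP V0 _; rewrite pnatr_eq0 dimv_eq0. Qed.

Lemma card_neq0 : #|K|%:R != 0 :> C.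
Proof. by rewrite pnatr_eq0 -lt0n cardG_gt0. Qed.

(** The frame operator of the orbit of [v]: up to the factor [#|K|], the average over [K] of the
    conjugates of the rank-one operator attached to [v]. *)
Definition frame (u : V) : V :=
  \sum_(k in K) '[u, theta k v] *: theta k v.

Fact frame_linear : linear frame.
Proof.
move=> a x y; rewrite /frame scaler_sumr -big_split; apply: eq_bigr => k _ /=.
by rewrite linearPl scalerDl scalerA.
Qed.

HB.instance Definition _ := GRing.isLinear.Build C V V _ frame frame_linear.

(** Reindexing by left translation puts [theta h] in both entries of the scalar product, where
    unitarity cancels it. *)
Lemma frame_comm h u : h \in K -> frame (theta h u) = theta h (frame u).
Proof.
move=> hK; rewrite /frame linear_sum -(@sum_mull _ h) //.
by apply: eq_bigr => k kK /=; rewrite linearZ /= reprM // repr_iso.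
Qed.

Lemma trace_frame :
  \sum_(i < \dim {:V}) coord (vbasis {:V}) i (frame (vbasis {:V})`_i) = #|K|%:R.
Proof.
under eq_bigr do rewrite linear_sum.
rewrite exchange_big /= -sum1_card natr_sum; apply: eq_bigr => k kK.
rewrite -v_unit -(@repr_iso k) //.
(* Expanding the first entry of the squared norm of [theta k v] in the basis gives the trace of the
   rank-one operator attached to [theta k v]. *)
rewrite {3}(coord_vbasis (memvf (theta k v))) linear_sumlz /=.
by apply: eq_bigr => i _; rewrite linearZ /= linearZl_LR /= mulrC.
Qed.

Lemma frameE u : frame u = (#|K|%:R / d) *: u.
Proof.
have [|a aE] := @schur _ _ _ K theta (linfun frame) theta_irr.
  by move=> k kK w; rewrite !lfunE /= frame_comm.
have {}aE w : frame w = a *: w by rewrite -aE lfunE.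
rewrite aE -trace_frame; congr (_ *: _); apply: (canRL (mulfK dim_neq0)).
under eq_bigr => i _.
  rewrite aE linearZ /= coord_free ?(basis_free (vbasisP _)) // eqxx mulr1.
over.
by rewrite sumr_const card_ord mulr_natr.
Qed.

(** The scalar product of [frame x] with [y], computed termwise and by [frameE]. *)
Lemma schur_orthogonality x y :
  \sum_(k in K) '[x, theta k v] * '[theta k v, y] = #|K|%:R / d * '[x, y].
Proof.
rewrite -[RHS]linearZl_LR /= -frameE linear_sumlz /=.
by apply: eq_bigr => k _; rewrite linearZl_LR.
Qed.

End Frame.

Section Embedding.
Variables (C : numClosedFieldType) (gT : finGroupType) (K : {group gT}).
Variables (V : vectType C) (dotV : {dot V for conjC}) (theta : gT -> 'End(V)).
Variable v : V.

Hypothesis theta_unitary : unitary_repr K dotV theta.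
Hypothesis theta_irr : irreducible_repr K theta.
Hypothesis v_unit : dotV v v = 1.

Local Notation d := ((\dim {:V})%:R : C).
Local Notation s := (sqrtC (d / #|K|%:R)).
Local Notation T := (Tv K dotV theta v).
Local Notation "''[' x , y ]" := (dotV x y).

Lemma sqrs : s * s = d / #|K|%:R.
Proof. by rewrite -expr2 sqrtCK. Qed.

Lemma conjs : s^* = s.
Proof. by apply/CrealP/ger0_real; rewrite sqrtC_ge0 divr_ge0 ?ler0n. Qed.

Lemma indE (f : Ind K theta) g k :
  k \in K -> ind_fun f (g * k)%g = theta k^-1%g (ind_fun f g).
Proof.
by move=> kK; case: f => f /= /forallP/(_ g)/forall_inP/(_ k kK)/eqP.
Qed.

Lemma sum_mulr (M : nmodType) h (F : gT -> M) : \sum_g F (g * h)%g = \sum_g F g.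
Proof. by rewrite [RHS](reindex_inj (mulIg h)). Qed.

(** All right translates of [F] have the same sum. This allows summation along the cosets of [K]
    without choosing representatives, and yields the normalisation of [dotInd]. *)
Lemma sum_average (F : gT -> C) :
  \sum_g F g = #|K|%:R^-1 * \sum_g \sum_(k in K) F (g * k)%g.
Proof.
rewrite exchange_big /=; under [in RHS]eq_bigr => k _ do rewrite sum_mulr.
by rewrite sumr_const -[X in _ * X]mulr_natl mulKf ?card_neq0.
Qed.

Lemma Tv_intertwiner : intertwiner (lambdaInd K theta) (lambdaL C gT) T.
Proof.
split=> [a x y | g f]; apply/ffunP => h; rewrite !ffunE //=.
by rewrite linearPl mulrDr mulrCA.
Qed.

(** On the coset of [g], equivariance moves [k] from the functions onto [v], so the inner sum is the
    one in [schur_orthogonality]; its constant is the inverse of [s * s]. *)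
Lemma Tv_isometry : isometry (dotL C gT) (dotInd K dotV theta) T.
Proof.
move=> f1 f2; rewrite [LHS]sum_average /dotInd; congr (_ * _).
apply: eq_bigr => g _.
under eq_bigr => k kK.
  rewrite !ffunE !indE // rmorphM /= conjs mulrACA sqrs.
  rewrite !(repr_adj theta_unitary) // dot_conj.
over.
rewrite -mulr_sumr (schur_orthogonality theta_unitary theta_irr v_unit).
rewrite -invf_div mulKf // mulf_neq0 ?invr_eq0 ?card_neq0 //.
exact: dim_neq0 theta_irr.
Qed.

(** The adjoint of [T]; the formula is read off from the scalar product of [F] with [T f], summed
    along cosets. *)
Definition Tv_adj_fun (F : L C gT) : {ffun gT -> V} :=
  [ffun g => s *: \sum_(k in K) F (g * k)%g *: theta k v].

Fact Tv_adj_subproof (F : L C gT) : Tv_adj_fun F \in ind_pred K theta.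
Proof.
apply/forallP => g; apply/forall_inP => h hK; rewrite !ffunE linearZ /=.
apply/eqP; congr (_ *: _); rewrite linear_sum -[RHS](sum_mull _ hK) /=.
apply: eq_bigr => k kK.
by rewrite linearZ /= -(reprM theta_unitary) ?groupV ?groupM // mulKg mulgA.
Qed.

Definition Tv_adj (F : L C gT) : Ind K theta := MkInd (Tv_adj_subproof F).

Lemma Tv_adjP F f : dotL C gT F (T f) = dotInd K dotV theta (Tv_adj F) f.
Proof.
rewrite [LHS]sum_average /dotInd; congr (_ * _); apply: eq_bigr => g _.
rewrite !ffunE linearZl_LR linear_sumlz /= mulr_sumr.
apply: eq_bigr => k kK; rewrite linearZl_LR /= !ffunE indE // rmorphM /= conjs.
by rewrite dot_conj mulrCA -dot_conj (repr_adj theta_unitary) // dot_conj.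
Qed.

(** The two factors [s] multiply to the constant of [psi], whose support cuts the convolution down
    to [K]. *)
Lemma conv_psiE F : conv F (psi K dotV theta v) = T (Tv_adj F).
Proof.
apply/ffunP => g; rewrite !ffunE linearZl_LR /= mulrA sqrs linear_sumlz /=.
rewrite mulr_sumr (bigID [in K]) /= [X in _ + X]big1 ?addr0 => [|k /negPf kNK].
  (* Inversion turns [g * k^-1] into the argument [g * k] used by [Tv_adj], and unitarity carries
     [theta k^-1] to the other entry. *)
  rewrite (reindex_inj invg_inj) /=.
  apply: eq_big => [k|k]; first by rewrite groupV.
  rewrite groupV => kK; rewrite ffunE groupV kK invgK linearZl_LR mulrCA /=.
  by rewrite -(repr_adj theta_unitary) ?groupV // invgK.
by rewrite ffunE kNK mulr0.
Qed.

Lemma conv_linearl (f : L C gT) : linear (fun F : L C gT => conv F f).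
Proof.
move=> a x y; apply/ffunP => g; rewrite !ffunE scaler_sumr -big_split.
by apply: eq_bigr => h _; rewrite !ffunE mulrDl scalerAl.
Qed.

Lemma conv_psi_projection :
  orthogonal_projection (dotL C gT)
    (fun F => exists f : Ind K theta, T f = F)
    (fun F => conv F (psi K dotV theta v)).
Proof.
split=> [|F]; first exact: conv_linearl.
rewrite conv_psiE; split=> [|_ [f <-]]; first by exists (Tv_adj F).
(* Both scalar products with [T f], that of [F] and that of [T (Tv_adj F)], equal the one of
   [Tv_adj F] with [f]. *)
by rewrite linearBl /= Tv_isometry Tv_adjP subrr.
Qed.

End Embedding.

Local Open Scope complex_scope.

Theorem proposition5p2 (R : realType) (gT : finGroupType) (K : {group gT})
    (V : vectType R[i]) (dotV : {dot V for conjC}) (theta : gT -> 'End(V))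
    (v : V) :
  unitary_repr K dotV theta ->
  irreducible_repr K theta ->
  sqrtC (dotV v v) = 1 ->
  let T : Ind K theta -> L R[i] gT := Tv K dotV theta v in
  let P : L R[i] gT -> L R[i] gT := fun f => conv f (psi K dotV theta v) in
  (intertwiner (lambdaInd K theta) (lambdaL R[i] gT) T /\
   isometry (dotL R[i] gT) (dotInd K dotV theta) T) /\
  orthogonal_projection (dotL R[i] gT)
    (fun F => exists f : Ind K theta, T f = F) P.
Proof.
move=> unit irr /(congr1 (fun x => x ^+ 2)); rewrite sqrtCK expr1n => v_unit T P.
split; last exact: conv_psi_projection.
by split; [exact: Tv_intertwiner | exact: Tv_isometry].
Qed.
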